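(* Let $n$ be the number of vertices and let $\epsilon,\delta>0$ satisfy $e^{4\epsilon}\delta<1/(16n)$. Every $(\epsilon,\delta)$-differentially oblivious $(3/4,1/3)$-tester for connectivity in graphs with maximal degree $2$ (in the incidence lists model) runs in time $\Omega(\sqrt{n}/e^{2\epsilon})$.
   Context: Incidence lists model with degree bound $d$: a graph $G$ on vertex set $V$, $|V|=n$, of maximal degree at most $d$ is represented by $f_G:V\times[d]\to V\cup\{0\}$ where $f_G(v,i)$ is the $i$-th neighbor of $v$ ($0$ if it does not exist); the tester accesses the graph by querying (probing) this function. The distance between two $n$-vertex graphs is $\mathrm{dist}_d(G_1,G_2)=|\{(v,i):v\in V,i\in[d],f_{G_1}(v,i)\ne f_{G_2}(v,i)\}|/(dn)$, and $G$ is $\gamma$-far from a property (set of graphs of maximal degree $d$) ${\cal P}$ if its distance to every $n$-vertex graph in ${\cal P}$ exceeds $\gamma$. A $(\beta,\gamma)$-tester for ${\cal P}$ is a probabilistic algorithm that outputs $1$ with probability at least $\beta$ if $G\in{\cal P}$ and outputs $0$ with probability at least $\beta$ if $G$ is $\gamma$-far from ${\cal P}$. Here ${\cal P}$ is the set of connected graphs of maximal degree $2$. Two $n$-vertex graphs are neighbors if one is obtained from the other by changing the neighbors of exactly one vertex. The tester is $(\epsilon,\delta)$-differentially oblivious if for all neighboring graphs $G,G'$ and every set $S$ of access patterns, $\Pr[\mathsf{Access}(G)\in S]\le e^{\epsilon}\Pr[\mathsf{Access}(G')\in S]+\delta$, where $\mathsf{Access}(G)$ is the ordered sequence of memory accesses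 of the tester on $G$. *)

(* Defs.v *)
From Stdlib Require Import Reals.
From mathcomp Require Import all_boot.
Local Open Scope R_scope.
Set Implicit Arguments. Unset Strict Implicit. Unset Printing Implicit Defensive.

(* Degree bound d = 2.  Vertex set V = 'I_n; index set [d] = 'I_2;
   the value 0 ("no neighbor") is encoded as None. *)
Definition query (n : nat) : finType := ('I_n * 'I_2)%type.
Definition igraph (n : nat) := 'I_n -> 'I_2 -> option 'I_n.

Definition nbrs n (f : igraph n) (u : 'I_n) : seq 'I_n :=
  pmap (fun x : option _ => x) [:: f u ord0; f u ord_max].

Definition adj n (f : igraph n) : rel 'I_n := fun u w => w \in nbrs f u.

(* f is the incidence-list representation of a simple undirected graph of
   maximal degree 2: slots are filled in order (the i-th neighbor is 0 iff
   fewer than i neighbors), no repeated neighbors, no loops, symmetric. *)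
Definition valid n (f : igraph n) : Prop :=
  forall u : 'I_n,
    [/\ (f u ord0 == None) ==> (f u ord_max == None),
        uniq (nbrs f u),
        u \notin nbrs f u
      & forall w, (w \in nbrs f u) = (u \in nbrs f w)].

Definition connected n (f : igraph n) : Prop :=
  forall u w : 'I_n, connect (adj f) u w.

Definition inP n (f : igraph n) : Prop := valid f /\ connected f.

Definition dist n (f g : igraph n) : R :=
  Rdiv (INR #|[set x : query n | f x.1 x.2 != g x.1 x.2]|) (INR (2 * n)%N).

Definition far n (gamma : R) (f : igraph n) : Prop :=
  forall g : igraph n, inP g -> (gamma < dist f g).

(* Two graphs are neighbors: obtained one from the other by changing the
   neighbors of exactly one vertex v (all other incidence lists agree once
   v is deleted from them). *)
Definition neighboring n (f g : igraph n) : Prop :=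
  exists v : 'I_n, forall u : 'I_n, u != v ->
    filter (predC1 v) (nbrs f u) = filter (predC1 v) (nbrs g u).

(* A probabilistic adaptive query algorithm: a random seed drawn from a
   finite probability space, and for each seed a deterministic strategy
   that, given the history of (probe, answer) pairs, either makes a next
   probe or stops; and an output function. *)
Definition history n := seq (query n * option 'I_n).

Record algo (n : nat) := Algo {
  seed : finType;
  prob : seed -> R;
  next : seed -> history n -> option (query n);
  out  : seed -> history n -> bool }.
Arguments seed {n}.
Arguments prob {n} a _.
Arguments next {n} a _ _.
Arguments out {n} a _ _.

Fixpoint run n (nx : history n -> option (query n)) (f : igraph n)
    (k : nat) (h : history n) : history n :=
  match k with
  | 0 => h
  | k.+1 => match nx h with
            | None => h
            | Some q => run nx f k (rcons h (q, f q.1 q.2))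
            end
  end.

Definition prob_dist n (A : algo n) : Prop :=
  (forall r, 0 <= prob A r) /\ \big[Rplus/0]_(r : seed A) prob A r = 1.

Definition time_bound n (A : algo n) (T : nat) : Prop :=
  forall (f : igraph n) (r : seed A), valid f ->
    next A r (run (next A r) f T [::]) = None.

Definition transcript n (A : algo n) (T : nat) (f : igraph n) (r : seed A) :=
  run (next A r) f T [::].

Definition access n (A : algo n) T f r : seq (query n) :=
  map fst (@transcript n A T f r).

Definition output n (A : algo n) T f r : bool := out A r (@transcript n A T f r).

Definition Pr n (A : algo n) (E : pred (seed A)) : R :=
  \big[Rplus/0]_(r : seed A | E r) prob A r.

Definition is_tester n (A : algo n) (T : nat) (beta gamma : R) : Prop :=
  (forall f, inP f -> (beta <= @Pr n A (fun r : seed A => @output n A T f r))) /\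
  (forall f, valid f -> far gamma f ->
     (beta <= @Pr n A (fun r : seed A => ~~ @output n A T f r))).

Definition diff_oblivious n (A : algo n) (T : nat) (eps delta : R) : Prop :=
  forall f g : igraph n, valid f -> valid g -> neighboring f g ->
  forall S : pred (seq (query n)),
    (@Pr n A (fun r : seed A => S (@access n A T f r)) <=
       exp eps * @Pr n A (fun r : seed A => S (@access n A T g r)) + delta).

(* Main.v *)
Require Import Defs.
From HB Require Import structures.
From Stdlib Require Import Reals Lra.
From mathcomp Require Import all_boot all_fingroup zify.
Set Implicit Arguments. Unset Strict Implicit. Unset Printing Implicit Defensive.
Local Open Scope R_scope.

(** Take a Hamiltonian cycle, and a disjoint union of triangles with one to
    three isolated vertices, both with uniformly random labels.  The second
    graph is 1/3-far from connected only thanks to its isolated vertices: the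
    triangles alone are at distance exactly 1/3.

    As long as no two vertices probed on the cycle are within distance 2, the
    probes together with their neighbors form disjoint triples, and a given
    family of m = O(sqrt n) such triples is almost as likely to show up in the
    triangles as in the cycle.  So a tester must probe two vertices of the cycle
    at distance at most 2 with constant probability.

    On the other hand, exchanging the label of a vertex v with that of a random
    vertex takes three neighboring steps and again yields a random cycle, in
    which v and its former successors are at random places, and are both probed
    with probability O(T^2 / n^2).  Differential obliviousness transfers this
    to the original cycle; summing over v, a close pair is probed with
    probability at most O(exp (3 eps) T^2 / n) + 3 n exp (2 eps) delta. *)

(** * Finite sums of reals *)

Lemma RplusA : associative Rplus. Proof. by move=> *; lra. Qed.
HB.instance Definition _ :=
  Monoid.isComLaw.Build R 0 Rplus RplusA Rplus_comm Rplus_0_l.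

Lemma sumR_le (I : finType) (P : pred I) (F G : I -> R) :
  (forall i, P i -> F i <= G i) ->
  \big[Rplus/0]_(i | P i) F i <= \big[Rplus/0]_(i | P i) G i.
Proof. by move=> FG; apply: (big_ind2 Rle) => // *; lra. Qed.

Lemma sumR_ge0 (I : finType) (P : pred I) (F : I -> R) :
  (forall i, P i -> 0 <= F i) -> 0 <= \big[Rplus/0]_(i | P i) F i.
Proof. by move=> F0; apply: (big_ind (Rle 0)) => // *; lra. Qed.

Lemma sumR_mull (I : finType) (P : pred I) (a : R) (F : I -> R) :
  a * \big[Rplus/0]_(i | P i) F i = \big[Rplus/0]_(i | P i) (a * F i).
Proof. by apply: (big_ind2 (fun x y => a * x = y)) => // *; lra. Qed.

Lemma sumR_const (I : finType) (P : pred I) (a : R) :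
  \big[Rplus/0]_(i | P i) a = INR #|P| * a.
Proof.
rewrite big_const; elim: #|P| => [|k IH]; first by rewrite /=; lra.
by rewrite iterS IH S_INR; lra.
Qed.

Lemma sumR_card (I : finType) (P Q : pred I) (a : R) :
  \big[Rplus/0]_(i | P i) (if Q i then a else 0) = INR #|[pred i | P i && Q i]| * a.
Proof. by rewrite -big_mkcondr sumR_const. Qed.

(** * Probabilities and expectations over the seed *)

Section Averages.
Variables (n : nat) (A : algo n).
Hypothesis dA : prob_dist A.

Lemma PrE (E : pred (seed A)) :
  Pr E = \big[Rplus/0]_r (if E r then prob A r else 0).
Proof. by rewrite /Pr big_mkcond. Qed.

Lemma Pr_mono (E F : pred (seed A)) : (forall r, E r -> F r) -> Pr E <= Pr F.
Proof.
case: dA => p0 _ EF; rewrite !PrE; apply: sumR_le => r _.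
have := p0 r; case: ifP => [/EF ->|_]; first lra.
by case: ifP => _; lra.
Qed.

Lemma PrC (E : pred (seed A)) : Pr (fun r => ~~ E r) = 1 - Pr E.
Proof.
case: dA => _ <-; rewrite !PrE.
suff <- : \big[Rplus/0]_r (if E r then prob A r else 0) +
     \big[Rplus/0]_r (if ~~ E r then prob A r else 0) = \big[Rplus/0]_r prob A r.
  by lra.
by rewrite -big_split; apply: eq_bigr => r _ /=; case: ifP => _ /=; lra.
Qed.

Lemma sum_Pr (I : finType) (E : I -> pred (seed A)) :
  \big[Rplus/0]_i Pr (E i) = \big[Rplus/0]_r (prob A r * INR #|[pred i | E i r]|).
Proof.
under eq_bigr => i _ do rewrite PrE.
by rewrite exchange_big; apply: eq_bigr => r _; rewrite sumR_card Rmult_comm.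
Qed.

Lemma expectation_le (X : seed A -> R) (c : R) :
  (forall r, X r <= c) -> \big[Rplus/0]_r (prob A r * X r) <= c.
Proof.
case: dA => p0 p1 Xc.
suff: \big[Rplus/0]_r (prob A r * X r) <= c * \big[Rplus/0]_r prob A r.
  by rewrite p1; lra.
rewrite sumR_mull; apply: sumR_le => r _.
by have := Rmult_le_compat_l _ _ _ (p0 r) (Xc r); lra.
Qed.

Lemma Pr_exists (I : finType) (E : I -> pred (seed A)) :
  Pr (fun r => [exists i, E i r]) <= \big[Rplus/0]_i Pr (E i).
Proof.
rewrite PrE sum_Pr; apply: sumR_le => r _.
case: dA => /(_ r) p0 _; case: ifP => [/existsP [i Ei]|_]; last first.
  by apply: Rmult_le_pos => //; apply: pos_INR.
have h : (0 < #|[pred i | E i r]|)%N by apply/card_gt0P; exists i; rewrite inE.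
have := le_INR 1 _ (elimT leP h); rewrite /= => h1.
have := Rmult_le_compat_l _ _ _ p0 h1; lra.
Qed.

End Averages.

(** * Runs of a deterministic query strategy *)

Section Runs.
Variables (n : nat).
Implicit Types (f g : igraph n) (nx : history n -> option (query n)).

Lemma size_run nx f k h : (size (run nx f k h) <= size h + k)%N.
Proof.
elim: k h => [|k IH] h /=; first by rewrite addn0.
case: (nx h) => [q|]; last by rewrite leq_addr.
by apply: (leq_trans (IH _)); rewrite size_rcons addSnnS.
Qed.

Lemma run_subset nx f k h : {subset h <= run nx f k h}.
Proof.
elim: k h => [|k IH] h x xh //=.
case: (nx h) => [q|] //; apply: IH; by rewrite mem_rcons inE xh orbT.
Qed.

Lemma run_agree nx f g k h :
  (forall x, x \in run nx f k h -> f x.1.1 x.1.2 = g x.1.1 x.1.2) ->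
  run nx g k h = run nx f k h.
Proof.
elim: k h => [|k IH] h //=.
case: (nx h) => [q|] // fg.
have <- : f q.1 q.2 = g q.1 q.2.
  apply: (fg (q, f q.1 q.2)); apply: run_subset.
  by rewrite mem_rcons inE eqxx.
exact: IH.
Qed.

End Runs.

(** * Graphs given by partial successor and predecessor maps *)

Section LinkGraphs.
Variable n : nat.
Implicit Types (s p : 'I_n -> option 'I_n) (u v w : 'I_n) (x : option 'I_n).

(** Without a successor, the predecessor moves to slot [ord0], because [valid] wants the slots
    filled in order. *)
Definition link s p : igraph n := fun u i =>
  match s u with
  | Some w => if i == ord0 then Some w else p u
  | None => if i == ord0 then p u else None
  end.

Lemma nbrs_link s p u : nbrs (link s p) u = pmap id [:: s u; p u].
Proof. by rewrite /nbrs /link /=; case: (s u); case: (p u). Qed.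

Lemma mem_nbrs_link s p u w :
  (w \in nbrs (link s p) u) = (s u == Some w) || (p u == Some w).
Proof.
rewrite nbrs_link mem_pmap map_id !inE [Some w == s u]eq_sym.
by rewrite [Some w == p u]eq_sym.
Qed.

Lemma valid_link s p :
  (forall u w, (s u == Some w) = (p w == Some u)) ->
  (forall u, s u != Some u) ->
  (forall u w, s u = Some w -> p u <> Some w) -> valid (link s p).
Proof.
move=> sp s1 s2 u; split.
- by rewrite /link; case: (s u) => [a|] /=; rewrite ?eqxx // implybT.
- rewrite nbrs_link /=; case: (s u) (s2 u) => [a|] /=; case: (p u) => [b|] //= /(_ a erefl) h.
  by rewrite inE andbT; apply/eqP => ab; case: h; rewrite ab.
- by rewrite mem_nbrs_link -sp (negPf (s1 u)).
- by move=> w; rewrite !mem_nbrs_link (sp u w) -(sp w u) orbC.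
Qed.

(** Slotwise counterpart of [filter (predC1 v)] in [neighboring]. *)
Definition hide v x := if x == Some v then None else x.

Lemma neighboring_link v s p s' p' :
  (forall u, u != v -> hide v (s u) = hide v (s' u)) ->
  (forall u, u != v -> hide v (p u) = hide v (p' u)) ->
  neighboring (link s p) (link s' p').
Proof.
move=> hs hp; exists v => u uv.
have E a b : filter (predC1 v) (pmap id [:: a; b]) = pmap id [:: hide v a; hide v b].
  rewrite /hide; case: a => [a|]; case: b => [b|] //=; rewrite ?(inj_eq Some_inj) /=.
  - by case: (a =P v); case: (b =P v).
  - by case: (a =P v).
  - by case: (b =P v).
by rewrite !nbrs_link !E hs // hp.
Qed.

Definition del v s u := if u == v then None else hide v (s u).

Lemma hide_idem v x : hide v (hide v x) = hide v x.
Proof. by rewrite /hide; case: (x =P Some v) => // /eqP; case: ifP. Qed.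

Lemma hideE v x w : (hide v x == Some w) = (x == Some w) && (w != v).
Proof.
rewrite /hide; case: (x =P Some v) => [->|xv].
  by rewrite (inj_eq Some_inj) [v == w]eq_sym; case: (w =P v).
by case: (x =P Some w) => [xw|] //=; apply/esym/eqP => wv; rewrite xw wv in xv.
Qed.

Lemma delE v s u w : (del v s u == Some w) = [&& u != v, s u == Some w & w != v].
Proof. by rewrite /del; case: (u =P v) => //= _; rewrite hideE. Qed.

Lemma valid_del v s p :
  (forall u w, (s u == Some w) = (p w == Some u)) ->
  (forall u, s u != Some u) ->
  (forall u w, s u = Some w -> p u <> Some w) -> valid (link (del v s) (del v p)).
Proof.
move=> sp s1 s2; apply: valid_link.
- by move=> u w; rewrite !delE sp andbA andbAC -andbA [RHS]andbC -!andbA; do !bool_congr.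
- by move=> u; rewrite delE negb_and (negPf (s1 u)) orbT.
- move=> u w /eqP; rewrite delE => /and3P [_ /eqP /s2 h _] /eqP.
  by rewrite delE => /and3P [_ /eqP].
Qed.

Lemma neighboring_del v s p :
  neighboring (link s p) (link (del v s) (del v p)) /\
  neighboring (link (del v s) (del v p)) (link s p).
Proof.
by split; apply: (@neighboring_link v) => u uv; rewrite /del (negPf uv) hide_idem.
Qed.

End LinkGraphs.

(** * Graphs of permutations and the exchange of two labels *)

Section PermGraphs.
Variable n : nat.
Implicit Types (pi rho : {perm 'I_n}) (u v w : 'I_n).
Local Open Scope group_scope.

(* Fixed points of the permutation become isolated vertices. *)
Definition parc pi u : option 'I_n := if pi u == u then None else Some (pi u).

Definition permgraph pi : igraph n := link (parc pi) (parc pi^-1).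

Lemma permgraph_nonfixed pi u i : pi u != u ->
  permgraph pi u i = if i == ord0 then Some (pi u) else Some (pi^-1 u).
Proof.
move=> h; rewrite /permgraph /link /parc (negPf h).
suff -> : (pi^-1 u == u) = false by [].
by apply/negP => /eqP e; move/eqP: h; apply; rewrite -{1}e permKV.
Qed.

Lemma parcE pi u w : (parc pi u == Some w) = (u != w) && (pi u == w).
Proof.
rewrite /parc; case: (pi u =P u) => [->|h]; first by case: (u =P w).
rewrite (inj_eq Some_inj) andbC; case: (pi u =P w) => // e.
by apply/esym/eqP => uw; case: h; rewrite e uw.
Qed.

(** A 2-cycle would list the same neighbor in both slots, which [valid] forbids. *)
Definition no2cycle pi := forall u, pi u != u -> pi (pi u) != u.

Lemma parcV pi u w : (parc pi u == Some w) = (parc pi^-1 w == Some u).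
Proof.
by rewrite !parcE (can2_eq (permK pi) (permKV pi)) [w == u]eq_sym [u == pi^-1 w]eq_sym.
 Qed.

Lemma parc_irrefl pi u : parc pi u != Some u.
Proof. by rewrite parcE eqxx. Qed.

Lemma parc_simple pi : no2cycle pi ->
  forall u w, parc pi u = Some w -> parc pi^-1 u <> Some w.
Proof.
move=> h u w /eqP; rewrite parcE => /andP [uw /eqP piu] /eqP.
rewrite -parcV parcE => /andP [_ /eqP piw].
by move: (h u); rewrite piu piw eqxx eq_sym uw => /(_ isT).
Qed.

Lemma valid_permgraph pi : no2cycle pi -> valid (permgraph pi).
Proof.
by move=> h; apply: valid_link; [exact: parcV|exact: parc_irrefl|exact: parc_simple].
Qed.

Lemma no2cycleJ pi (s : {perm 'I_n}) : no2cycle pi -> no2cycle (pi ^ s).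
Proof.
move=> h u; rewrite -(permKV s u) !permJ !(inj_eq perm_inj); exact: h.
Qed.

Lemma parcJ pi (s : {perm 'I_n}) u : parc (pi ^ s) (s u) = omap s (parc pi u).
Proof. by rewrite /parc permJ (inj_eq perm_inj); case: ifP. Qed.

(** In the lists of other vertices, conjugation only exchanges the names [v] and [y], and both are
    hidden. So once [v] is deleted, the relabelling amounts to a change at the single vertex [y]. *)
Lemma hide_tperm pi v y u : u != v -> u != y ->
  hide y (hide v (parc pi u)) = hide y (hide v (parc (pi ^ tperm v y) u)).
Proof.
move=> uv uy; rewrite -{2}(@tpermD _ v y u) 1?eq_sym // parcJ.
have hv : hide y (hide v (Some v)) = None by rewrite /hide eqxx.
have hy : hide y (hide v (Some y)) = None.
  by rewrite [hide v _]/hide; case: ifP => // _; rewrite /hide eqxx.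
by case: (parc pi u) => [w|] //=; case: tpermP => [->|->|] //; rewrite hv hy.
Qed.

(* Swapping the labels v and y is done by changing three vertices: isolate v,
   let y take the place of v, and let v take the former place of y. *)
Lemma swap_chain pi v y : no2cycle pi ->
  exists f g, [/\ valid f, valid g &
   [/\ neighboring (permgraph pi) f, neighboring f g
     & neighboring g (permgraph (pi ^ tperm v y))]].
Proof.
move=> h; set pi' := pi ^ _.
have h' : no2cycle pi' by apply: no2cycleJ.
exists (link (del v (parc pi)) (del v (parc pi^-1))).
exists (link (del v (parc pi')) (del v (parc pi'^-1))); split.
- by apply: valid_del; [exact: parcV|exact: parc_irrefl|exact: parc_simple].
- by apply: valid_del; [exact: parcV|exact: parc_irrefl|exact: parc_simple].
split; [exact: (neighboring_del v _ _).1| |exact: (neighboring_del v _ _).2].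
apply: (@neighboring_link _ y) => u uy; rewrite /del; case: eqP => // /eqP uv.
  exact: hide_tperm.
by rewrite /pi' -conjVg; apply: hide_tperm.
Qed.

End PermGraphs.

(** * Distance of a union of triangles from connectivity *)

Section Distance.
Variable n : nat.
Implicit Types (pi : {perm 'I_n}) (f g : igraph n) (u v w z : 'I_n).
Local Open Scope group_scope.

Lemma mem_nbrs g u w : (w \in nbrs g u) = (g u ord0 == Some w) || (g u ord_max == Some w).
Proof.
rewrite /nbrs mem_pmap map_id !inE [Some w == g u ord0]eq_sym.
by rewrite [Some w == g u ord_max]eq_sym.
Qed.

Definition ndiff f g u : nat := (f u ord0 != g u ord0) + (f u ord_max != g u ord_max).

Lemma card_diff f g :
  #|[set x : query n | f x.1 x.2 != g x.1 x.2]| = \sum_u ndiff f g u.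
Proof.
rewrite cardsE -sum1_card big_mkcond /=.
rewrite -(pair_bigA _ (fun u i => nat_of_bool (f u i != g u i))) /=.
apply: eq_bigr => u _; rewrite big_ord_recr big_ord1 /= /ndiff.
by congr (nat_of_bool (f u _ != g u _) + _)%N; apply: val_inj.
Qed.

Lemma connect_escape g (S : pred 'I_n) u z :
  connect (adj g) u z -> S u -> ~~ S z -> exists a w, [/\ S a, ~~ S w & w \in nbrs g a].
Proof.
case/connectP => q; elim: q u => [|y q IH] u /=; first by move=> _ -> ->.
case/andP => uy yq zE Su Sz.
by have [Sy|nSy] := boolP (S y); [apply: (IH y)|exists u, y].
Qed.

(** The slot of [a] holding [w] is one difference. If the other slot of [a] is unchanged, the
    triangle vertex displaced by [w] is no neighbor of [a] in [g]; by symmetry of [g] its own slot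
    for [a] is a second difference. *)
Lemma ndiff_escape f g a b c w :
  f a ord0 = Some b -> f a ord_max = Some c -> f b ord_max = Some a ->
  f c ord0 = Some a -> valid g -> b != c ->
  w \in nbrs g a -> w != b -> w != c ->
  (2 <= ndiff f g a + ndiff f g b + ndiff f g c)%N.
Proof.
move=> fa0 fa1 fb fc vg bc aw wb wc.
have symg y : (y \in nbrs g a) = (a \in nbrs g y) by case: (vg a) => _ _ _; apply.
have := symg b; have := symg c; rewrite !mem_nbrs /ndiff fa0 fa1 fb fc.
rewrite ![Some _ == g _ _]eq_sym.
move: aw; rewrite mem_nbrs => /orP [] /eqP ->; rewrite !(inj_eq Some_inj).
  rewrite (negPf wb) (negPf wc) /= => _.
  case: (g a ord_max =P Some c) => [->|_ _]; last by lia.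
  by rewrite (inj_eq Some_inj) [c == b]eq_sym (negPf bc); do 3!case: (_ == _).
rewrite (negPf wb) (negPf wc) !orbF => h _.
case: (g a ord0 =P Some b) h => [->|_ _]; last by lia.
by rewrite (inj_eq Some_inj) (negPf bc); case: (g c ord0 == _) => //=; lia.
Qed.

(** The fixed point [z] lies outside the triangle of [u], so the connected graph [g] has an edge
    leaving that triangle. Rotating the triangle lets [ndiff_escape] apply at the endpoint of this
    edge. *)
Lemma ndiff_triangle pi g u z :
  (forall x, pi (pi (pi x)) = x) -> inP g -> pi u != u -> pi z = z ->
  (2 <= ndiff (permgraph pi) g u + ndiff (permgraph pi) g (pi u)
        + ndiff (permgraph pi) g (pi (pi u)))%N.
Proof.
move=> pi3 [vg cg] piu piz.
have piV x : pi^-1 x = pi (pi x) by rewrite -{1}(pi3 x) permK.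
have key a w : pi a != a -> w \in nbrs g a -> w != pi a -> w != pi (pi a) ->
   (2 <= ndiff (permgraph pi) g a + ndiff (permgraph pi) g (pi a)
        + ndiff (permgraph pi) g (pi (pi a)))%N.
  move=> pia aw wb wc; apply: (ndiff_escape _ _ _ _ vg _ aw wb wc).
  - by rewrite permgraph_nonfixed.
  - by rewrite permgraph_nonfixed //= piV.
  - by rewrite permgraph_nonfixed ?permK // (inj_eq perm_inj).
  - have nf : pi (pi (pi a)) != pi (pi a) by rewrite !(inj_eq perm_inj).
    by rewrite permgraph_nonfixed // pi3.
  - by rewrite (inj_eq perm_inj) eq_sym.
pose S := [pred x | x \in [:: u; pi u; pi (pi u)]].
have nSz : ~~ S z.
  by rewrite /S /= !inE -{2}piz -{3}piz -{3}piz !(inj_eq perm_inj) !orbb;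
     apply: contra piu => /eqP <-; rewrite piz.
have Su : S u by rewrite /S /= inE eqxx.
have [a [w [Sa nSw aw]]] := connect_escape (cg u z) Su nSz.
move: nSw; rewrite /S /= !inE !negb_or => /and3P [wu w1 w2].
move: Sa; rewrite /S /= !inE => /or3P [] /eqP aE; rewrite {a}aE in aw.
- exact: (key u w).
- have nf : pi (pi u) != pi u by rewrite (inj_eq perm_inj).
  by have := key (pi u) w nf aw; rewrite !pi3 => /(_ w2 wu); lia.
- have nf : pi (pi (pi u)) != pi (pi u) by rewrite !(inj_eq perm_inj).
  by have := key (pi (pi u)) w nf aw; rewrite !pi3 => /(_ wu w1); lia.
Qed.

Lemma ndiff_isolated pi g u z : inP g -> pi u = u -> z != u ->
  (1 <= ndiff (permgraph pi) g u)%N.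
Proof.
move=> [vg cg] piu zu.
have [a [w [/= /eqP -> _]]] := @connect_escape g (pred1 u) u z (cg u z) (eqxx u) zu.
have [g0 _ _ _] := vg u; move: g0.
rewrite mem_nbrs /ndiff /permgraph /link /parc piu eqxx /=.
have -> : pi^-1 u = u by rewrite -{1}piu permK.
by rewrite eqxx; case: (g u ord0) => [?|] //=; case: (g u ord_max).
Qed.

(* Summing the three rotations of [ndiff] over all vertices counts every
   triangle three times, each time with at least 2 differences. *)
Lemma far_triangles pi z : (1 < n)%N ->
  (forall x, pi (pi (pi x)) = x) -> pi z = z -> far (1/3) (permgraph pi).
Proof.
move=> n1 pi3 piz g Pg; rewrite /Defs.dist card_diff.
set c := ndiff _ g.
have E : (3 * \sum_u c u = \sum_u (c u + c (pi u) + c (pi (pi u))))%N.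
  move: c => c.
  have e1 : (\sum_u c (pi u) = \sum_u c u)%N.
    by rewrite [RHS](reindex_inj (@perm_inj _ pi)).
  have e2 : (\sum_u c (pi (pi u)) = \sum_u c (pi u))%N.
    by rewrite [RHS](reindex_inj (@perm_inj _ pi)).
  by rewrite !big_split /= e2 e1 !mulSn mul0n addn0 addnA.
(* At a fixed point the three terms coincide and add up to at least 3. This surplus, present at [z],
   is what makes the distance strictly larger than 1/3. *)
have c2 u : (2 + (pi u == u) <= c u + c (pi u) + c (pi (pi u)))%N.
  case: (eqVneq (pi u) u) => [piu|piu]; last first.
    by rewrite addn0; apply: (@ndiff_triangle _ _ _ z).
  have [y yu] : exists y, y != u.
    case: (eqVneq u z) => [->|uz]; last by exists z; rewrite eq_sym.
    have n0 : (0 < n)%N by lia.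
    case: (eqVneq (Ordinal n1) z) => [<-|]; last by exists (Ordinal n1).
    by exists (Ordinal n0).
  by have := ndiff_isolated Pg piu yu; rewrite !piu -/(c u); lia.
have h : (2 * n < 3 * \sum_u c u)%N.
  rewrite E; apply: (@leq_trans (\sum_u (2 + (pi u == u)))%N); last by apply: leq_sum.
  rewrite big_split /= sum_nat_const card_ord mulnC -addn1 leq_add2l.
  by rewrite (bigD1 z) //= piz eqxx.
move/ltP/lt_INR: h; rewrite (mult_INR 3) => h.
have n0 : 0 < INR (2 * n)%N by apply/lt_0_INR/ltP; lia.
apply: (Rmult_lt_reg_r _ _ _ n0).
have -> (a : R) : Rmult (Rdiv a (INR (2 * n))) (INR (2 * n)) = a by field; lra.
by move: h; rewrite /=; lra.
Qed.

End Distance.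

(** * The Hamiltonian cycle and the disjoint triangles *)

Section BasePermutations.
Variable n : nat.
Local Open Scope group_scope.

Definition cycle_perm : {perm 'I_n} := perm (@ordS_inj n).

Lemma cycle_permE (x : 'I_n) : cycle_perm x = (x.+1 %% n)%N :> nat.
Proof. by rewrite permE. Qed.

Lemma cycle_perm_neq (x : 'I_n) : (2 < n)%N ->
  cycle_perm x != x /\ cycle_perm (cycle_perm x) != x.
Proof.
move=> n3; rewrite -!val_eqE /= !cycle_permE; have xn := ltn_ord x.
case: (ltngtP x.+1 n) => h; [|lia|by rewrite h modnn modn_small; lia].
rewrite (modn_small h); split; first lia.
case: (ltngtP x.+2 n) => h'; [by rewrite modn_small; lia|lia|by rewrite h' modnn; lia].
Qed.

Lemma connected_cycle (s : {perm 'I_n}) : (2 < n)%N ->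
  inP (permgraph (cycle_perm ^ s)).
Proof.
move=> n3; have v : valid (permgraph (cycle_perm ^ s)).
  by apply/valid_permgraph/no2cycleJ => u _; case: (cycle_perm_neq u n3).
split=> //.
have symc : connect_sym (adj (permgraph (cycle_perm ^ s))).
  by apply: sym_connect_sym => x y; rewrite /adj; case: (v x) => _ _ _ ->.
have n0 : (0 < n)%N by lia.
have base k (kn : (k < n)%N) :
   connect (adj (permgraph (cycle_perm ^ s))) (s (Ordinal n0)) (s (Ordinal kn)).
  elim: k kn => [|k IH] kn; first by rewrite (bool_irrelevance kn n0).
  have kn' : (k < n)%N by lia.
  apply: connect_trans (IH kn') _; apply: connect1.
  rewrite /adj mem_nbrs_link parcE permJ !(inj_eq perm_inj).
  have -> : cycle_perm (Ordinal kn') = Ordinal kn.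
    by apply: val_inj => /=; rewrite cycle_permE modn_small.
  by rewrite eqxx andbT -val_eqE /= neq_ltn ltnSn.
move=> u w; rewrite -(permKV s u) -(permKV s w).
case: (s^-1 u) (s^-1 w) => [k kn] [l ln].
by apply: connect_trans (base _ ln); rewrite symc; apply: base.
Qed.

(** Rotates consecutive blocks of three. Taking [(n - 1) %/ 3] blocks leaves a fixed point even when
    3 divides a positive [n]. The default of [insubd] is never reached, as the new value stays
    inside the block. *)
Definition rot3 (x : 'I_n) : 'I_n :=
  if (x < 3 * ((n - 1) %/ 3))%N
  then insubd x (if (x %% 3 == 2)%N then (x - 2)%N else x.+1) else x.

Lemma rot3K : cancel rot3 (rot3 \o rot3).
Proof.
move=> x; apply: val_inj => /=.
have E y : rot3 y = (if (y < 3 * ((n - 1) %/ 3))%N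
  then (if (y %% 3 == 2)%N then (y - 2)%N else y.+1) else y) :> nat.
  rewrite /rot3; case: ifP => // h; rewrite val_insubd ifT //.
  by have := ltn_ord y; case: ifP; lia.
rewrite !E; set t := (_ %/ 3)%N.
case: (ltnP x (3 * t)) => xt; last first.
  have xt' : (x < 3 * t)%N = false by lia.
  by rewrite !xt'.
have : (x %% 3 < 3)%N by rewrite ltn_mod.
case r: (x %% 3)%N => [|[|[|//]]] _ /=.
- have [-> -> ->] : [/\ (x.+1 < 3 * t)%N, (x.+1 %% 3 == 2)%N = false &
    (x.+2 < 3 * t)%N] by split; lia.
  have -> : (x.+2 %% 3 == 2)%N by lia.
  by lia.
- have [-> ->] : (x.+1 < 3 * t)%N /\ (x.+1 %% 3 == 2)%N by lia.
  have [-> ->] : (x.+1 - 2 < 3 * t)%N /\ ((x.+1 - 2) %% 3 == 2)%N = false by lia.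
  by lia.
- have [-> ->] : (x - 2 < 3 * t)%N /\ ((x - 2) %% 3 == 2)%N = false by lia.
  have [-> ->] : ((x - 2).+1 < 3 * t)%N /\ ((x - 2).+1 %% 3 == 2)%N = false by lia.
  by lia.
Qed.

Definition triangles_perm : {perm 'I_n} := perm (can_inj rot3K).

Lemma triangles_perm3 x : triangles_perm (triangles_perm (triangles_perm x)) = x.
Proof. by rewrite !permE; apply: rot3K. Qed.

Lemma triangles_perm_fix : (0 < n)%N -> exists z, triangles_perm z = z.
Proof.
move=> n0; have h : (n.-1 < n)%N by lia.
by exists (Ordinal h); rewrite permE /rot3; case: ifP => //= k; lia.
Qed.

Lemma card_triangles_perm_fix : (#|[pred x | triangles_perm x == x]| <= 3)%N.
Proof.
apply: (@leq_trans (\sum_(i < n | 3 * ((n - 1) %/ 3) <= i) 1)%N).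
  rewrite -sum1_card [X in (_ <= X)%N]big_mkcond [X in (X <= _)%N]big_mkcond /=.
  apply: leq_sum => x _; rewrite inE permE /rot3; case: ltnP => h; last by case: ifP.
  case: eqP => // /(congr1 val); rewrite val_insubd ifT /=; last first.
    by have := ltn_ord x; case: ifP; lia.
  by case: ifP; lia.
have := @big_geq_mkord _ 0%N addn (3 * ((n - 1) %/ 3)) n predT (fun=> 1%N).
by rewrite sum_nat_const_nat => <-; lia.
Qed.

End BasePermutations.

(** * Fiberwise comparison of cardinals, and Bernoulli's inequality *)

Section Counting.
Local Open Scope nat_scope.

(** Fibers over distinct keys are disjoint, so the inequalities add up; the induction removes one
    fiber from both sets. *)
Lemma card_fiber_transfer (X Y : finType) (K : eqType) (L : X -> K) (M : Y -> K)
    (a b : nat) (A : {set X}) (B : {set Y}) :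
  (forall x, x \in A -> a * #|[set x' in A | L x' == L x]|
                     <= b * #|[set y in B | M y == L x]|) ->
  a * #|A| <= b * #|B|.
Proof.
have [k] := ubnP #|A|; elim: k => // k IH in A B * => Ak h.
have [->|[x xA]] := set_0Vmem A; first by rewrite cards0 muln0.
pose A' := [set x' in A | L x' != L x]; pose B' := [set y in B | M y != L x].
have EA : #|A| = #|[set x' in A | L x' == L x]| + #|A'|.
  rewrite -(cardsID [set x' | L x' == L x] A); congr (_ + _); apply: eq_card => y.
    by rewrite !inE.
  by rewrite !inE andbC.
have EB : #|B| = #|[set y in B | M y == L x]| + #|B'|.
  rewrite -(cardsID [set y | M y == L x] B); congr (_ + _); apply: eq_card => y.
    by rewrite !inE.
  by rewrite !inE andbC.
have pos : 0 < #|[set x' in A | L x' == L x]|.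
  by apply/card_gt0P; exists x; rewrite inE xA eqxx.
rewrite EA EB !mulnDr leq_add ?h //; apply: IH; first by lia.
move=> z; rewrite inE => /andP [zA zx]; have := h z zA.
suff [-> ->] : [set x' in A | L x' == L z] = [set x' in A' | L x' == L z] /\
   [set y in B | M y == L z] = [set y in B' | M y == L z] by [].
by split; apply/setP => y; rewrite !inE; case: eqP => [->|_]; rewrite ?andbF // zx !andbT.
Qed.

(** Bernoulli's inequality [(1 - a/n)^m >= 1 - m a/n], cleared of denominators. *)
Lemma bernoulli_nat (n a m : nat) : a * m <= n -> n ^ m * (n - m * a) <= (n - a) ^ m * n.
Proof.
elim: m => [|m IH] h; first by rewrite !expn0 mul0n subn0.
have /IH {}IH : a * m <= n by lia.
apply: (@leq_trans (n ^ m * (n - m * a) * (n - a))); last first.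
  by rewrite [(n - a) ^ m.+1]expnSr [X in _ <= X]mulnAC leq_mul2r IH orbT.
rewrite expnSr -!mulnA leq_mul2l; apply/orP; right.
move: h; rewrite mulnSr [a * m]mulnC mulSn => h.
by move: (m * a) h => q h; nia.
Qed.

(** Bernoulli with [a = 3 m] loses a fraction [3 m^2 / n], at most 1/10. *)
Lemma falling_ratio (n m : nat) : 0 < n -> 30 * (m * m) <= n ->
  9 * n ^ m <= 10 * (n - 3 * m) ^ m.
Proof.
move=> n0 h.
have /bernoulli_nat b : 3 * m * m <= n by lia.
rewrite -(leq_pmul2r n0).
apply: (@leq_trans (10 * (n ^ m * (n - m * (3 * m))))); last first.
  by rewrite -!mulnA leq_mul2l b orbT.
rewrite [9 * _]mulnC [10 * _]mulnC -!mulnA leq_mul2l; apply/orP; right.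
by lia.
Qed.

End Counting.

(** * Labellings that explain given probes *)

Section PermCounting.
Local Open Scope nat_scope.
Variable T : finType.
Implicit Types (s : seq T) (pi sigma rho : {perm T}).
Local Open Scope group_scope.

Lemma perm_extend s s' : uniq s -> uniq s' -> size s = size s' ->
  exists rho : {perm T}, map rho s = s'.
Proof.
elim: s s' => [|x s IH] [|x' s'] //=; first by exists 1.
case/andP=> xs us /andP [xs' us'] [/(IH _ us us') [rho E]].
exists (rho * tperm (rho x) x'); rewrite permM tpermL; congr (_ :: _).
rewrite -E; apply/eq_in_map => y ys; rewrite permM tpermD //.
  by rewrite (inj_eq perm_inj); apply: contraNneq xs => ->.
by apply: contraNneq xs' => ->; rewrite -E map_f.
Qed.

(** Composing with a permutation that carries [s1] to [s2] is a bijection between the two sets. *)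
Lemma card_perm_map s1 s2 s' : uniq s1 -> uniq s2 -> size s1 = size s2 ->
  #|[pred sigma : {perm T} | map sigma s1 == s']| =
  #|[pred sigma : {perm T} | map sigma s2 == s']|.
Proof.
move=> u1 u2 /(perm_extend u1 u2) [rho E].
rewrite -!sum1_card (reindex_inj (mulgI rho)); apply: eq_bigl => sigma.
rewrite !inE -E -map_comp; congr (_ == _); apply: eq_map => x.
by rewrite permM.
Qed.

(** Its being [uniq] expresses that the triples of a vertex, its successor and its predecessor are
    nondegenerate and disjoint. *)
Definition trip pi s := s ++ map pi s ++ map pi^-1 s.

Lemma conj_map pi sigma s : map (pi ^ sigma) s = map sigma (map pi (map sigma^-1 s)).
Proof. by rewrite -!map_comp; apply: eq_map => x; rewrite conjgE !permM. Qed.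

Lemma map_perm_eq sigma s s' : (map sigma s == s') = (map sigma^-1 s' == s).
Proof.
apply/eqP/eqP => <-; rewrite -map_comp -[RHS]map_id; apply: eq_map => x /=.
  by rewrite permK.
by rewrite permKV.
Qed.

Definition consistent pi (U A B : seq T) :=
  [pred sigma : {perm T} | (map (pi ^ sigma) U == A) && (map (pi ^ sigma)^-1 U == B)].

(** Labellings are sorted by the tuple [P] of positions of [U]. Those with a given [P] must send
    [trip pi P] to [U ++ A ++ B]: none does if [trip pi P] has repetitions, and otherwise their
    number does not depend on [P]. So [pi] enters only through the first factor. *)
Lemma card_consistent pi U A B :
  uniq (U ++ A ++ B) -> size A = size U -> size B = size U ->
  #|consistent pi U A B| =
  (#|[pred P : (size U).-tuple T | uniq (trip pi P)]| *
   #|[pred sigma : {perm T} | map sigma (U ++ A ++ B) == U ++ A ++ B]|)%N.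
Proof.
move=> uS sA sB; rewrite -sum1_card.
rewrite (partition_big (fun sigma : {perm T} => map_tuple sigma^-1 (in_tuple U)) predT) //=.
rewrite -sum_nat_const [RHS]big_mkcond /=; apply: eq_bigr => P _.
have -> : \sum_(sigma in consistent pi U A B | map_tuple sigma^-1 (in_tuple U) == P) 1 =
   #|[pred sigma : {perm T} | map sigma (trip pi P) == U ++ A ++ B]|.
  rewrite -sum1_card; apply: eq_bigl => sigma.
  rewrite !inE /trip !map_cat eqseq_cat; last by rewrite size_map size_tuple.
  rewrite eqseq_cat; last by rewrite !size_map size_tuple sA.
  rewrite [map sigma P == U]map_perm_eq -val_eqE /= -conjVg !conj_map.
  by case: (map sigma^-1 U =P P) => [->|_]; rewrite ?andbT ?andbF.
rewrite inE; case: ifP => [uP|nuP].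
  by apply: card_perm_map => //; rewrite /trip !size_cat !size_map size_tuple sA sB.
apply: eq_card0 => sigma; rewrite inE; apply/negP => /eqP E.
by move: nuP; rewrite -(map_inj_uniq (@perm_inj _ sigma)) E uS.
Qed.

End PermCounting.

(** * Tuples of vertices from distinct triangles *)

Section TriangleTuples.
Local Open Scope nat_scope.
Variables (T : finType) (pi : {perm T}).
Hypothesis pi3 : forall x, pi (pi (pi x)) = x.
Hypothesis fix3 : #|[pred x | pi x == x]| <= 3.

Let piV x : (pi^-1)%g x = pi (pi x).
Proof. by rewrite -{1}(pi3 x) permK. Qed.

Lemma trip_closed s x : x \in trip pi s -> pi x \in trip pi s.
Proof.
rewrite /trip !mem_cat => /or3P [xs|/mapP [y ys ->]|/mapP [y ys ->]].
- by rewrite (map_f pi xs) orbT.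
- by rewrite -piV (map_f (pi^-1)%g ys) !orbT.
- by rewrite permKV ys.
Qed.

(** Since [pi^-1] is [pi] applied twice, [trip pi s] is a union of orbits, so the whole triangle of
    [x] avoids it as soon as [x] does. *)
Lemma uniq_trip_cons x s : uniq (trip pi s) -> pi x != x -> x \notin trip pi s ->
  uniq (trip pi (x :: s)).
Proof.
move=> us px xs.
have pE : perm_eq (trip pi (x :: s)) [:: x, pi x, (pi^-1)%g x & trip pi s].
  by apply/seq.permP => a; rewrite /trip /= !count_cat /= !count_cat /=; lia.
rewrite (perm_uniq pE) /= us !inE !negb_or piV.
have h1 : pi x \notin trip pi s.
  by apply: contra xs => /trip_closed /trip_closed; rewrite pi3.
have h2 : pi (pi x) \notin trip pi s.
  by apply: contra xs => /trip_closed; rewrite pi3.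
rewrite xs h1 h2 !andbT [x == pi x]eq_sym px /= [pi x == pi (pi x)]eq_sym.
rewrite (inj_eq perm_inj) px andbT.
by apply: contra px => /eqP {1}->; rewrite pi3.
Qed.

Lemma card_fresh s : #|T| - (3 + 3 * size s) <=
  #|[pred x | (pi x != x) && (x \notin trip pi s)]|.
Proof.
set ok := [pred x | _]; rewrite leq_subLR -(cardC ok) addnC leq_add2r.
apply: (@leq_trans #|[predU [pred x | pi x == x] & trip pi s]|).
  by apply: subset_leq_card; apply/subsetP => x; rewrite !inE negb_and !negbK.
apply: (@leq_trans (#|[pred x | pi x == x]| + #|trip pi s|)).
  by rewrite -cardUI leq_addr.
rewrite leq_add //; apply: leq_trans (card_size _) _.
by rewrite /trip !size_cat !size_map; lia.
Qed.

Lemma card_uniq_trip m k : m <= k ->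
  (#|T| - 3 * k) ^ m <= #|[pred P : m.-tuple T | uniq (trip pi P)]|.
Proof.
elim: m => [|m IH] mk.
  by rewrite expn0; apply/card_gt0P; exists [tuple]; rewrite inE.
pose D := [set p : m.-tuple T * T | uniq (trip pi p.1) &&
  ((pi p.2 != p.2) && (p.2 \notin trip pi p.1))].
pose F (p : m.-tuple T * T) := [tuple of p.2 :: p.1].
have injF : injective F.
  move=> [s x] [s' x'] /(congr1 val) /= [-> E]; congr (_, _); exact: val_inj.
apply: (@leq_trans #|F @: D|); last first.
  apply: subset_leq_card; apply/subsetP => P /imsetP [[s x]].
  by rewrite inE /= => /and3P [us px xs] ->; rewrite inE; apply: uniq_trip_cons.
rewrite card_imset // cardsE -sum1_card.
rewrite -(pair_big_dep (fun s : m.-tuple T => uniq (trip pi s))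
   (fun s x => (pi x != x) && (x \notin trip pi s)) (fun _ _ => 1)) /=.
apply: (@leq_trans (\sum_(s : m.-tuple T | uniq (trip pi s)) (#|T| - 3 * k))).
  by rewrite sum_nat_const expnSr leq_mul2r IH ?orbT // ltnW.
apply: leq_sum => s _; rewrite sum1_card.
(* Here [size s = m < k], so the 3 fixed points and the [3 * m] used vertices exclude at most
   [3 * k] choices. *)
by apply: leq_trans (card_fresh s); rewrite size_tuple; lia.
Qed.

End TriangleTuples.

(** * Comparison of runs on cycles and on triangles *)

Section Transfer.
Local Open Scope nat_scope.
Variables (n T : nat) (nx : history n -> option (query n)) (ou : history n -> bool).
Implicit Types (rho pi : {perm 'I_n}).

Definition probes rho := run nx (permgraph rho) T [::].
Definition probed rho := undup (map fst (map fst (probes rho))).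

Lemma size_probed rho : size (probed rho) <= T.
Proof.
by apply: leq_trans (size_undup _) _; rewrite !size_map; apply: size_run.
Qed.

(** Disjoint triples make every probed vertex non-fixed, so its slots are its successor and
    predecessor, which agree for [rho] and [rho']. Equal answers then give equal runs. *)
Lemma probes_agree rho rho' : uniq (trip rho (probed rho)) ->
  map rho' (probed rho) = map rho (probed rho) ->
  map (rho'^-1)%g (probed rho) = map (rho^-1)%g (probed rho) ->
  probes rho' = probes rho.
Proof.
move=> uU /eq_in_map E1 /eq_in_map E2; apply: run_agree => x xr.
have xU : x.1.1 \in probed rho by rewrite mem_undup; do 2!apply: map_f.
have nf : rho x.1.1 != x.1.1.
  apply/eqP => E; move: uU; rewrite /trip cat_uniq => /and3P [_ /hasPn h _].
  have := h x.1.1; rewrite mem_cat -{1}E (map_f rho xU) /= xU.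
  by move=> /(_ isT).
by rewrite !permgraph_nonfixed ?E1 // E2.
Qed.

Variables (piC piD : {perm 'I_n}).
Hypothesis piD3 : forall x, piD (piD (piD x)) = x.
Hypothesis fixD : #|[pred x | piD x == x]| <= 3.

Definition probe_key rho := (probed rho, map rho (probed rho), map (rho^-1)%g (probed rho)).

(* The two labellings are compared on each class of labellings with the same
   probed vertices and the same neighbors of these. *)
Lemma transfer : 0 < n -> 30 * (T * T) <= n ->
  9 * #|[set s : {perm 'I_n} | uniq (trip (piC ^ s)%g (probed (piC ^ s)%g)) &&
                               ou (probes (piC ^ s)%g)]|
  <= 10 * #|[set s : {perm 'I_n} | ou (probes (piD ^ s)%g)]|.
Proof.
move=> n0 Tn.
apply: (@card_fiber_transfer _ _ _ (fun s => probe_key (piC ^ s)%g)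
  (fun s => probe_key (piD ^ s)%g)) => s0; rewrite inE => /andP [u0 o0].
set rho := (piC ^ s0)%g in u0 o0 *.
set U := probed rho; set A := map rho U; set B := map (rho^-1)%g U.
have cc pi := @card_consistent _ pi U A B u0 (size_map _ _) (size_map _ _).
apply: (@leq_trans (9 * #|consistent piC U A B|)).
  rewrite leq_mul2l; apply/orP; right; apply: subset_leq_card; apply/subsetP => s.
  rewrite !inE => /andP [_ /eqP [E1 E2 E3]].
  by move: E2 E3; rewrite E1 /A /B /U => -> ->; rewrite !eqxx.
(* Conversely, every consistent labelling of the triangles reproduces the run, hence its key and its
   output. *)
apply: (@leq_trans (10 * #|consistent piD U A B|)); last first.
  rewrite leq_mul2l; apply/orP; right; apply: subset_leq_card; apply/subsetP => s.
  rewrite !inE => /andP [/eqP E1 /eqP E2].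
  have E := probes_agree u0 E1 E2.
  have EU : probed (piD ^ s)%g = U by rewrite /probed E.
  by rewrite E o0 /= /probe_key EU E1 E2.
(* The common second factor cancels; what remains compares at most [n ^ size U] tuples of the cycle
   with those of the triangles. *)
rewrite !cc !mulnA leq_mul2r; apply/orP; right.
have mT : size U <= T by apply: size_probed.
apply: (@leq_trans (9 * n ^ size U)).
  rewrite leq_mul2l; apply/orP; right.
  by apply: leq_trans (max_card _) _; rewrite card_tuple card_ord.
apply: (@leq_trans (10 * (n - 3 * size U) ^ size U)).
  by apply: falling_ratio => //; apply: leq_trans Tn; rewrite leq_mul2l leq_mul.
rewrite leq_mul2l; apply/orP; right.
by have := card_uniq_trip piD3 fixD (leqnn (size U)); rewrite card_ord.
Qed.

(** Two triples can only overlap if one probed vertex is reached from another in one or two steps of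
    [rho]. *)
Lemma uniq_trip_far rho (U : seq 'I_n) : uniq U ->
  (forall u, u \in U -> rho u \notin U /\ rho (rho u) \notin U) -> uniq (trip rho U).
Proof.
move=> uU h; rewrite /trip !cat_uniq uU !(map_inj_uniq perm_inj) uU /= andbT.
apply/andP; split; apply/hasPn => x.
  rewrite mem_cat => /orP [] /mapP [y yU ->]; first by case: (h y yU).
  by apply/negP => /h [/negP []]; rewrite permKV.
move=> /mapP [y yU ->]; apply/negP => /mapP [z zU E].
by case: (h z zU) => _ /negP; rewrite -E permKV.
Qed.

End Transfer.

(** * Obliviousness on random cycles *)

Lemma card_preim_seq (I J : finType) (F : I -> J) (X : seq J) : injective F ->
  (#|[pred i | F i \in X]| <= size X)%N.
Proof.
move=> injF; apply: leq_trans (card_size X).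
rewrite -(card_image injF); apply: subset_leq_card; apply/subsetP => y.
by case/imageP => i; rewrite inE => iX ->.
Qed.

Section ObliviousBound.
Variables (n T : nat) (A : algo n) (eps delta : R).
Hypothesis n3 : (2 < n)%N.
Hypothesis dA : prob_dist A.
Hypothesis eps0 : 0 < eps.
Hypothesis delta0 : 0 < delta.
Hypothesis doA : diff_oblivious A T eps delta.

Local Notation pi := (cycle_perm n).
Local Notation cyc s := (permgraph (pi ^ s)%g).

Definition hit (u w w' : 'I_n) (a : seq (query n)) :=
  (u \in map fst a) && ((w \in map fst a) || (w' \in map fst a)).

(** With [e = exp eps], three steps accumulate the error [(1 + e + e^2) delta], and [e > 1] bounds
    it by [3 e^2 delta]. *)
Lemma oblivious_chain f f1 f2 g (S : pred (seq (query n))) :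
  valid f -> valid f1 -> valid f2 -> valid g ->
  neighboring f f1 -> neighboring f1 f2 -> neighboring f2 g ->
  Pr (fun r : seed A => S (access T f r)) <=
  exp (3 * eps) * Pr (fun r : seed A => S (access T g r)) + 3 * exp (2 * eps) * delta.
Proof.
move=> vf vf1 vf2 vg n1 n2 n3'.
have h1 := doA vf vf1 n1 S; have h2 := doA vf1 vf2 n2 S; have h3 := doA vf2 vg n3' S.
have e1 : 1 < exp eps by rewrite -exp_0; apply: exp_increasing.
have -> : 3 * eps = eps + eps + eps by ring.
have -> : 2 * eps = eps + eps by ring.
rewrite !exp_plus; set e := exp eps in e1 h1 h2 h3 *.
have k2 := Rmult_le_compat_l e _ _ ltac:(lra) h2.
have k3 := Rmult_le_compat_l (e * e) _ _ ltac:(nra) h3.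
have ee : e <= e * e by nra.
have := Rmult_le_compat_r delta _ _ ltac:(lra) ee.
have := Rmult_le_compat_r delta 1 e ltac:(lra) ltac:(lra).
by lra.
Qed.

(** For [j = i] this is a close pair being probed; other values of [j] decouple the first vertex
    from the other two. *)
Definition hit_prob (s : {perm 'I_n}) i j : R :=
  Pr (fun r : seed A => hit (s j) (s (pi i)) (s (pi (pi i))) (access T (cyc s) r)).

Lemma valid_cycle (s : {perm 'I_n}) : valid (cyc s).
Proof. by case: (connected_cycle s n3). Qed.

(** Exchanging the labels [s i] and [s j] moves the label [s i] to position [j], while the two
    following positions keep their labels because [j] avoids them. *)
Lemma hit_prob_swap s i j : j != pi i -> j != pi (pi i) ->
  hit_prob s i i <=
  exp (3 * eps) * hit_prob (tperm i j * s)%g i j + 3 * exp (2 * eps) * delta.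
Proof.
move=> j1 j2; set s' := (_ * s)%g.
have [p1 p2] := cycle_perm_neq i n3.
have no2 : no2cycle (pi ^ s)%g.
  by apply: no2cycleJ => u _; case: (cycle_perm_neq u n3).
have [f1 [f2 [vf1 vf2 [h1 h2 h3]]]] := swap_chain (s i) (s j) no2.
have E : ((pi ^ s) ^ tperm (s i) (s j) = pi ^ s')%g.
  by rewrite -conjgM -tpermJ -conjgC.
rewrite E in h3.
have := oblivious_chain (hit (s i) (s (pi i)) (s (pi (pi i))))
  (valid_cycle s) vf1 vf2 (valid_cycle s') h1 h2 h3.
by rewrite /hit_prob /s' !permM tpermR !(@tpermD _ i j) // eq_sym.
Qed.

(** For each seed at most [T] vertices are probed, which allows at most [T] values of [j] and
    [2 * T] values of [i]. *)
Lemma sum_hit_prob_all s :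
  \big[Rplus/0]_i \big[Rplus/0]_j hit_prob s i j <= 2 * INR T ^ 2.
Proof.
rewrite pair_bigA /hit_prob.
rewrite (@sum_Pr n A _ (fun p r => hit (s p.2) (s (pi p.1)) (s (pi (pi p.1))) (access T (cyc s) r))).
apply: expectation_le => // r.
set a := map fst (access T (cyc s) r).
have aT : (size a <= T)%N by rewrite !size_map; apply: size_run.
have -> : 2 * INR T ^ 2 = INR (2 * (T * T))%N by rewrite !mult_INR /=; ring.
apply/le_INR/leP.
have inj1 : injective (fun i => s (pi i)) by move=> x y /perm_inj /perm_inj.
have inj2 : injective (fun i => s (pi (pi i))).
  by move=> x y /perm_inj /perm_inj /perm_inj.
have c0 := leq_trans (card_preim_seq a (@perm_inj _ s)) aT.
have c1 := leq_trans (card_preim_seq a inj1) aT.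
have c2 := leq_trans (card_preim_seq a inj2) aT.
set J := [pred j | s j \in a] in c0.
set I1 := [pred i | s (pi i) \in a] in c1.
set I2 := [pred i | s (pi (pi i)) \in a] in c2.
apply: (@leq_trans (#|[predU I1 & I2]| * #|J|)).
  rewrite -cardX; apply: subset_leq_card; apply/subsetP => -[i j].
  by rewrite !inE /= /hit -/a andbC.
have -> : (2 * (T * T) = (T + T) * T)%N by lia.
apply: leq_mul => //; apply: leq_trans (leq_add c1 c2).
by rewrite -cardUI leq_addr.
Qed.

Lemma sum_hit_prob :
  let M := INR #|{perm 'I_n}| in
  INR (n - 2) * \big[Rplus/0]_(s : {perm 'I_n}) \big[Rplus/0]_i hit_prob s i i <=
  exp (3 * eps) * (M * (2 * INR T ^ 2)) +
  INR n * (INR (n - 2) * (M * (3 * exp (2 * eps) * delta))).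
Proof.
move=> M; rewrite exchange_big /=.
have row i : INR (n - 2) * \big[Rplus/0]_(s : {perm 'I_n}) hit_prob s i i <=
   exp (3 * eps) * \big[Rplus/0]_j \big[Rplus/0]_(s : {perm 'I_n}) hit_prob s i j +
   INR (n - 2) * (M * (3 * exp (2 * eps) * delta)).
  pose ok := [pred j | (j != pi i) && (j != pi (pi i))].
  have cok : #|ok| = (n - 2)%N.
    have := cardC (pred2 (pi i) (pi (pi i))).
    rewrite card2 card_ord (inj_eq perm_inj) eq_sym (cycle_perm_neq i n3).1 /= => C.
    have -> : #|ok| = #|predC (pred2 (pi i) (pi (pi i)))|.
      by apply: eq_card => j; rewrite !inE negb_or.
    by rewrite -[X in (X - _)%N]C addKn.
  rewrite -cok -!(sumR_const ok) sumR_mull.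
  have step j : ok j -> \big[Rplus/0]_(s : {perm 'I_n}) hit_prob s i i <=
     exp (3 * eps) * \big[Rplus/0]_(s : {perm 'I_n}) hit_prob s i j +
     M * (3 * exp (2 * eps) * delta).
    case/andP => j1 j2; rewrite -sumR_const.
    (* The relabelled cycle is again uniform: [tperm i j * s] runs over all permutations as [s]
       does. *)
    rewrite [X in exp _ * X](reindex_inj (mulgI (tperm i j))) /= sumR_mull -big_split.
    by apply: sumR_le => s _; apply: hit_prob_swap.
  apply: Rle_trans (sumR_le step) _; rewrite big_split /=; apply: Rplus_le_compat_r.
  rewrite big_mkcond; apply: sumR_le => j _; case: ifP => _; first by apply: Rle_refl.
  apply: Rmult_le_pos; first exact/Rlt_le/exp_pos.
  apply: sumR_ge0 => s _; apply: sumR_ge0 => r _; exact: dA.1.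
rewrite sumR_mull; apply: Rle_trans (sumR_le (fun i _ => row i)) _.
rewrite big_split /= sumR_const card_ord -sumR_mull; apply: Rplus_le_compat_r.
apply: Rmult_le_compat_l; first exact/Rlt_le/exp_pos.
under eq_bigr => i _ do rewrite exchange_big.
rewrite exchange_big /= -sumR_const; apply: sumR_le => s _.
exact: sum_hit_prob_all.
Qed.

Definition collision (s : {perm 'I_n}) (r : seed A) :=
  ~~ uniq (trip (pi ^ s)%g (probed T (Defs.next A r) (pi ^ s)%g)).

(** Union bound over the position [i] of the first vertex of a close pair. *)
Lemma Pr_collision s : Pr (collision s) <= \big[Rplus/0]_i hit_prob s i i.
Proof.
apply: Rle_trans (Pr_exists dA _); apply: (Pr_mono dA) => r.
apply: contraR; rewrite negb_exists => /forallP h.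
apply: uniq_trip_far; first exact: undup_uniq.
move=> u uU; have := h ((s^-1)%g u).
have E1 x : (pi ^ s)%g x = s (pi ((s^-1)%g x)) by rewrite conjgE !permM.
have memE x : (x \in map fst (access T (cyc s) r)) =
  (x \in probed T (Defs.next A r) (pi ^ s)%g) by rewrite mem_undup.
rewrite /hit !memE permKV uU /= negb_or -E1 => /andP.
by rewrite {2}E1 [X in _ -> _ /\ ~~ (X \in _)]E1 E1 permK.
Qed.

Lemma collision_transfer (r : seed A) : (30 * (T * T) <= n)%N ->
  (9 * #|[pred s : {perm 'I_n} | output T (permgraph (pi ^ s)%g) r]| <=
   9 * #|[pred s | collision s r]| +
   10 * #|[pred s : {perm 'I_n} | output T (permgraph (triangles_perm n ^ s)%g) r]|)%N.
Proof.
move=> Tn.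
have n0 : (0 < n)%N by lia.
have := @transfer n T (Defs.next A r) (out A r) pi (triangles_perm n)
  (@triangles_perm3 n) (@card_triangles_perm_fix n) n0 Tn.
rewrite !cardsE => h; apply: leq_trans (leq_add (leqnn _) h).
rewrite -mulnDr leq_mul2l; apply/orP; right.
rewrite -cardUI; apply: leq_trans (leq_addr _ _).
apply: subset_leq_card; apply/subsetP => s; rewrite !inE => o.
by rewrite /collision unfold_in; case: uniq => //=; exact: o.
Qed.

(** On average the cycles are accepted with probability at least 3/4 and the triangles at most 1/4,
    so collisions have weight at least [3/4 - (10/9) (1/4) = 17/36]. *)
Lemma collision_likely : (30 * (T * T) <= n)%N -> is_tester A T (3/4) (1/3) ->
  17 / 36 * INR #|{perm 'I_n}| <= \big[Rplus/0]_(s : {perm 'I_n}) Pr (collision s).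
Proof.
move=> Tn [acc rej]; set M := INR _; set Bt := \big[_/_]_s _.
pose X := \big[Rplus/0]_(s : {perm 'I_n})
  Pr (fun r : seed A => output T (permgraph (pi ^ s)%g) r).
pose Y := \big[Rplus/0]_(s : {perm 'I_n})
  Pr (fun r : seed A => output T (permgraph (triangles_perm n ^ s)%g) r).
have hX : M * (3/4) <= X.
  rewrite -sumR_const; apply: sumR_le => s _; apply: acc; exact: connected_cycle.
have hY : Y <= M * (1/4).
  rewrite -sumR_const; apply: sumR_le => s _.
  set piD := (triangles_perm n ^ s)%g.
  have piD3 x : piD (piD (piD x)) = x.
    by rewrite -(permKV s x) !permJ triangles_perm3.
  have [z piz] : exists z, piD z = z.
    have [z zE] := @triangles_perm_fix n ltac:(lia).
    by exists (s z); rewrite permJ zE.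
  have no2 : no2cycle piD.
    by move=> u; apply: contra => /eqP E; rewrite -{1}E piD3.
  have := rej _ (valid_permgraph no2) (far_triangles (ltnW n3) piD3 piz).
  by rewrite (PrC dA (fun r => output T (permgraph piD) r)); lra.
have : 9 * X <= 9 * Bt + 10 * Y.
  rewrite /X /Y /Bt !sum_Pr !sumR_mull -big_split; apply: sumR_le => r _.
  have := le_INR _ _ (elimT leP (collision_transfer r Tn)).
  have INRM a b : INR (a * b)%N = INR a * INR b by apply: mult_INR.
  have INRD a b : INR (a + b)%N = INR a + INR b by apply: plus_INR.
  rewrite INRD !INRM => h.
  have scale p x y z : 0 <= p -> INR 9 * x <= INR 9 * y + INR 10 * z ->
      9 * (p * x) <= 9 * (p * y) + 10 * (p * z).
    by move=> p0 xyz; have := Rmult_le_compat_l p _ _ p0 xyz; rewrite /=; lra.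
  exact: scale (dA.1 r) h.
by lra.
Qed.

End ObliviousBound.

(** * Choice of constants and the final estimate *)

Theorem theorem2 :
  exists c : R, (0 < c) /\ exists N : nat, forall n : nat, (N <= n)%N ->
  forall eps delta : R, (0 < eps) -> (0 < delta) ->
  (exp (4 * eps) * delta < 1 / (16 * INR n)) ->
  forall (A : algo n) (T : nat),
    prob_dist A -> time_bound A T ->
    is_tester A T (3/4) (1/3) ->
    diff_oblivious A T eps delta ->
    (c * sqrt (INR n) / exp (2 * eps) <= INR T).
Proof.
(* If the bound fails, [(T e)^2 <= n / 100] with [e = exp (2 eps)]. This gives both [30 T^2 <= n]
   and a hitting term of at most [n / 50]. *)
exists (1/10); split; first by lra.
exists 4%N => n n4 eps delta eps0 delta0 small A T dA _ tA doA.
have n3 : (2 < n)%N by lia.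
have nR : 4 <= INR n by have := le_INR 4 n (elimT leP n4); rewrite /=; lra.
apply: Rnot_lt_le => lt.
set e := exp (2 * eps) in lt *.
have e1 : 1 < e by rewrite -exp_0; apply: exp_increasing; lra.
have T0 := pos_INR T.
have lt' : INR T * e < 1/10 * sqrt (INR n).
  have := Rmult_lt_compat_r e _ _ ltac:(lra) lt.
  by have -> : 1 / 10 * sqrt (INR n) / e * e = 1 / 10 * sqrt (INR n) by field; lra.
have sq := sqrt_sqrt (INR n) ltac:(lra).
have sq0 := sqrt_pos (INR n).
have le_sq x y : 0 <= x -> x <= y -> x * x <= y * y.
  by move=> x0 xy; apply: Rmult_le_compat.
have Te : (INR T * e) * (INR T * e) <= INR n / 100.
  have Te0 : 0 <= INR T * e by apply: Rmult_le_pos; lra.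
  by have := le_sq _ _ Te0 (Rlt_le _ _ lt'); lra.
have Tn : (30 * (T * T) <= n)%N.
  apply/leP/INR_le; rewrite !mult_INR.
  have := le_sq (INR T) (INR T * e) T0 ltac:(nra).
  by rewrite /=; lra.
have E4 : exp (4 * eps) = e * e by rewrite -exp_plus; congr exp; ring.
have E3 : exp (3 * eps) <= e * e by rewrite -E4; apply/Rlt_le/exp_increasing; lra.
have h1 := sum_hit_prob n3 dA eps0 delta0 doA.
have h2 := collision_likely n3 dA Tn tA.
set M := INR #|{perm 'I_n}| in h1 h2.
have M0 : 0 < M.
  by apply/lt_0_INR/ltP/card_gt0P; exists 1%g.
have h3 : 17 / 36 * M <= \big[Rplus/0]_(s : {perm 'I_n}) \big[Rplus/0]_i hit_prob T A s i i.
  by apply: Rle_trans h2 _; apply: sumR_le => s _; apply: Pr_collision.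
have K : INR (n - 2) = INR n - 2 by rewrite minus_INR /=; [lra|lia].
move: h1; rewrite -/e K => h1.
have h4 : (INR n - 2) * (17 / 36 * M) <=
   M * (e * e * (2 * INR T ^ 2)) + M * (INR n - 2) * (INR n * (3 * e * delta)).
  apply: Rle_trans (Rmult_le_compat_l (INR n - 2) _ _ ltac:(lra) h3) _.
  apply: Rle_trans h1 _.
  have := Rmult_le_compat_r (M * (2 * INR T ^ 2)) _ _ ltac:(nra) E3.
  by lra.
(* The assumption reads [e^2 delta < 1 / (16 n)], and [e <= e^2]. *)
have h5 : INR n * (3 * e * delta) <= 3 / 16.
  rewrite E4 in small.
  have := Rmult_lt_compat_l (INR n) _ _ ltac:(lra) small.
  have -> : INR n * (1 / (16 * INR n)) = 1 / 16 by field; lra.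
  have := Rmult_le_compat_r (INR n * delta) e (e * e) ltac:(nra) ltac:(nra).
  by lra.
have h6 : (INR n - 2) * (17 / 36) <=
   2 * ((INR T * e) * (INR T * e)) + (INR n - 2) * (INR n * (3 * e * delta)).
  by apply: (Rmult_le_reg_l M) => //; lra.
(* What remains is [(17/36 - 3/16) (n - 2) <= n / 50], which is false for [n >= 4]. *)
have := Rmult_le_compat_l (INR n - 2) _ _ ltac:(lra) h5.
by lra.
Qed.
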